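(* Let $\mu_1,\mu_2$ be probability measures on $\mathbb{R}$, let $\rho:\mathcal{P}(\mathbb{R})\to\mathbb{R}$ be a law-invariant risk measure, and let $\pi=(\pi_1,\pi_2)\in\Sigma_2$ with $\pi_1,\pi_2>0$. Assume that the function $\Sigma_2\ni(p_1,p_2)\mapsto\rho(p_1\mu_1+p_2\mu_2)$ is continuous. For $r\in\mathbb{R}$ let $$H_{\rho,\langle\pi,\mu\rangle}(r):=\inf\left\{\sum_{j=1}^2p_j\log\frac{p_j}{\pi_j}:(p_1,p_2)\in\Sigma_2,\ \rho(p_1\mu_1+p_2\mu_2)=r\right\}.$$ Assume that there exist strictly decreasing functions $\Psi_\rho(\mu_1,\cdot),\Psi_\rho(\mu_2,\cdot):\mathbb{R}\to\mathbb{R}$ such that, for all $r\in\mathbb{R}$, $$H_{\rho,\langle\pi,\mu\rangle}(r)=\inf\left\{\sum_{j=1}^2p_j\log\frac{p_j}{\pi_j}:(p_1,p_2)\in\Sigma_2,\ \sum_{j=1}^2p_j\Psi_\rho(\mu_j,r)=0\right\},$$ and such that for each $i\in\{1,2\}$ there exists a unique $r_i^{(0)}\in\mathbb{R}$ with $\Psi_\rho(\mu_i,r_i^{(0)})=0$. Assume $r_1^{(0)}\neq r_2^{(0)}$. Then for every $r\in\left(\min\{r_1^{(0)},r_2^{(0)}\},\max\{r_1^{(0)},r_2^{(0)}\}\right)$ one has $\Psi_\rho(\mu_1,r)\Psi_\rho(\mu_2,r)<0$, the number $\lambda_*(r)\in\mathbb{R}$ such that $$\frac{\sum_{j=1}^2\pi_j\Psi_\rho(\mu_j,r)e^{-\lambda_*(r)\Psi_\rho(\mu_j,r)}}{\sum_{j=1}^2\pi_je^{-\lambda_*(r)\Psi_\rho(\mu_j,r)}}=0$$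 is given by $$\lambda_*(r)=-\frac{1}{\Psi_\rho(\mu_2,r)-\Psi_\rho(\mu_1,r)}\log\left(-\frac{\pi_1\Psi_\rho(\mu_1,r)}{\pi_2\Psi_\rho(\mu_2,r)}\right),$$ and $$H_{\rho,\langle\pi,\mu\rangle}(r)=-\log\left(\sum_{h=1}^2\pi_h\left(-\frac{\pi_1\Psi_\rho(\mu_1,r)}{\pi_2\Psi_\rho(\mu_2,r)}\right)^{\frac{\Psi_\rho(\mu_h,r)}{\Psi_\rho(\mu_2,r)-\Psi_\rho(\mu_1,r)}}\right).$$
   Context: $\mathcal{P}(\mathbb{R})$ is the set of probability measures on the real line; a law-invariant risk measure is any map $\rho:\mathcal{P}(\mathbb{R})\to\mathbb{R}$. The simplex is $\Sigma_2:=\{(p_1,p_2):p_1,p_2\geq 0,\ p_1+p_2=1\}$. Conventions: $p_j\log\frac{p_j}{\pi_j}=0$ if $p_j=0$; $\inf\emptyset=\infty$. The notation $\Psi_\rho(\mu_i,\cdot)$ just denotes a real function attached to the index $i$. *)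

(* Defs.v *)
From HB Require Import structures.
From mathcomp Require Import all_boot all_order all_algebra.
From mathcomp Require Import all_classical all_reals all_analysis.

Set Implicit Arguments.
Unset Strict Implicit.
Unset Printing Implicit Defensive.

Import Order.TTheory GRing.Theory Num.Theory.
Import numFieldNormedType.Exports.

Local Open Scope classical_set_scope.
Local Open Scope ring_scope.

(* Borel probability measures on the real line. *)
Notation law R := (probability (measurableTypeR R) R).

(* A [probability] is a function on all subsets whose values outside the Borel
   sets are irrelevant, so a map on P(R) is a map on [law R] that identifies
   two laws with the same values on the Borel sets. *)
Definition law_invariant (R : realType) (rho : law R -> R) : Prop :=
  forall P Q : law R,
    (forall A : set (measurableTypeR R), measurable A -> P A = Q A) ->
    rho P = rho Q.

(* As a type, [simplex2 R] is the subtype of [R * R], with the topology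
   induced by that of [R * R]. *)
Definition simplex2 (R : realType) : set (R * R) :=
  [set p | [/\ 0 <= p.1, 0 <= p.2 & p.1 + p.2 = 1]].

Arguments simplex2 R : clear implicits.

Section simplex2.
Context (R : realType).

Definition weight1 (p : simplex2 R) : R := (set_val p).1.
Definition weight2 (p : simplex2 R) : R := (set_val p).2.

Lemma weight1_ge0 (p : simplex2 R) : 0 <= weight1 p.
Proof. by case: (set_valP p). Qed.

Lemma weight2_ge0 (p : simplex2 R) : 0 <= weight2 p.
Proof. by case: (set_valP p). Qed.

Lemma weightD (p : simplex2 R) : weight1 p + weight2 p = 1.
Proof. by case: (set_valP p). Qed.

End simplex2.

Section mixture.
Context (R : realType) (p : simplex2 R) (mu1 mu2 : law R).

Definition mixture_measure : set (measurableTypeR R) -> \bar R :=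
  measure_add (mscale (NngNum (weight1_ge0 p)) mu1)
              (mscale (NngNum (weight2_ge0 p)) mu2).

HB.instance Definition _ := Measure.on mixture_measure.

Lemma mixture_measureE A :
  mixture_measure A = ((weight1 p)%:E * mu1 A + (weight2 p)%:E * mu2 A)%E.
Proof. by rewrite /mixture_measure measure_addE. Qed.

Lemma mixture_measure_setT : mixture_measure [set: measurableTypeR R] = 1%E.
Proof.
by rewrite mixture_measureE !probability_setT !mule1 -EFinD weightD.
Qed.

HB.instance Definition _ :=
  Measure_isProbability.Build _ _ _ mixture_measure mixture_measure_setT.

Definition mixture : law R := mixture_measure.

End mixture.

(* The convention for vanishing weights holds since [0 * _ = 0]. *)
Definition relative_entropy (R : realType) (p pi : simplex2 R) : R :=
  weight1 p * ln (weight1 p / weight1 pi) +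
  weight2 p * ln (weight2 p / weight2 pi).

(* [ereal_inf set0 = +oo]. *)
Definition min_entropy (R : realType) (pi : simplex2 R)
    (C : set (simplex2 R)) : \bar R :=
  ereal_inf [set (relative_entropy p pi)%:E | p in C].

Definition rateH (R : realType) (rho : law R -> R) (pi : simplex2 R)
    (mu1 mu2 : law R) (r : R) : \bar R :=
  min_entropy pi [set p | rho (mixture p mu1 mu2) = r].

(* Main.v *)
Require Import Defs.
From HB Require Import structures.
From mathcomp Require Import all_boot all_order all_algebra.
From mathcomp Require Import all_classical all_reals all_analysis.
From mathcomp Require Import ring.

Set Implicit Arguments.
Unset Strict Implicit.
Unset Printing Implicit Defensive.

Import Order.TTheory GRing.Theory Num.Theory.
Import numFieldNormedType.Exports.

Local Open Scope classical_set_scope.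
Local Open Scope ring_scope.

(* The level set [rho = r] may be replaced, by hypothesis, with the hyperplane
   [p1 * Psi1 r + p2 * Psi2 r = 0].  Since [Psi1 r] and [Psi2 r] have opposite
   signs, this hyperplane meets the simplex in exactly one point [p], so the
   rate is the relative entropy of [p]; and [q] is the ratio
   [(p2 / pi2) / (p1 / pi1)] of its densities. *)

(** At [r] the function whose zero is the left endpoint is already negative, while the one whose
    zero is the right endpoint is still positive. *)
Lemma mulr_lt0_between_zeros (R : realDomainType) (f g : R -> R) (x y r : R) :
    {homo f : u v / u < v >-> v < u} -> {homo g : u v / u < v >-> v < u} ->
    f x = 0 -> g y = 0 -> Num.min x y < r < Num.max x y ->
  f r * g r < 0.
Proof.
move=> f_decr g_decr fx gy; case: (ltP x y) => _ /andP[lt_r gt_r].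
- have := f_decr _ _ lt_r; have := g_decr _ _ gt_r.
  by rewrite fx gy => g_gt0 f_lt0; rewrite nmulr_rlt0.
- have := f_decr _ _ gt_r; have := g_decr _ _ lt_r.
  by rewrite fx gy => g_lt0 f_gt0; rewrite pmulr_rlt0.
Qed.

Lemma mulr_lt0_opp_div_gt0 (R : realFieldType) (a b : R) :
  a * b < 0 -> 0 < - (a / b).
Proof.
move=> ab_lt0; have b_neq0 : b != 0.
  by apply: contraTneq ab_lt0 => ->; rewrite mulr0 ltxx.
have -> : - (a / b) = - (a * b) / b ^+ 2 by field.
by rewrite divr_gt0 ?oppr_gt0// exprn_even_gt0.
Qed.

Lemma mulr_lt0_sub_neq0 (R : realDomainType) (a b : R) :
  a * b < 0 -> b - a != 0.
Proof.
by apply: contraTneq => /eqP; rewrite subr_eq0 => /eqP->;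
  rewrite -expr2 -leNgt sqr_ge0.
Qed.

(** The denominator is positive, so only the numerator matters. Factoring
    [w2 * b * expR (- lambda * a)], which is nonzero, out of it leaves
    [expR (- lambda * (b - a)) - q], where [q] is the positive argument of the logarithm; its only
    zero in [lambda] is found by taking logarithms. *)
Lemma tilted_mean_eq0 (R : realType) (w1 w2 a b lambda : R) :
    0 < w1 -> 0 < w2 -> a * b < 0 ->
  (w1 * a * expR (- lambda * a) + w2 * b * expR (- lambda * b))
    / (w1 * expR (- lambda * a) + w2 * expR (- lambda * b)) = 0
  <-> lambda = - (1 / (b - a)) * ln (- (w1 * a / (w2 * b))).
Proof.
move=> w1_gt0 w2_gt0 ab_lt0.
have ba_neq0 := mulr_lt0_sub_neq0 ab_lt0.
have b_neq0 : b != 0 by apply: contraTneq ab_lt0 => ->; rewrite mulr0 ltxx.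
have q_gt0 : 0 < - (w1 * a / (w2 * b)).
  by apply: mulr_lt0_opp_div_gt0; rewrite mulrACA pmulr_rlt0 ?mulr_gt0.
set q := - _ in q_gt0 *.
have den_neq0 : w1 * expR (- lambda * a) + w2 * expR (- lambda * b) != 0.
  by rewrite gt_eqF// addr_gt0// mulr_gt0// expR_gt0.
have w2_neq0 : w2 != 0 by rewrite gt_eqF.
have eb : expR (- lambda * b) =
    expR (- lambda * a) * expR (- lambda * (b - a)).
  by rewrite -expRD; congr expR; ring.
have num : w1 * a * expR (- lambda * a) + w2 * b * expR (- lambda * b) =
    w2 * b * expR (- lambda * a) * (expR (- lambda * (b - a)) - q).
  by rewrite eb /q; field; rewrite b_neq0 w2_neq0.
have c_neq0 : w2 * b * expR (- lambda * a) != 0.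
  by rewrite !mulf_neq0// gt_eqF// expR_gt0.
split=> [/eqP|lambdaE].
- rewrite mulf_eq0 invr_eq0 (negbTE den_neq0) orbF num mulf_eq0.
  rewrite (negbTE c_neq0) subr_eq0 => /eqP <-.
  by rewrite expRK; field.
- suff q_exp : expR (- lambda * (b - a)) = q.
    by rewrite num q_exp subrr mulr0 mul0r.
  rewrite -[RHS]lnK ?posrE//; congr expR; rewrite lambdaE; field.
  exact: ba_neq0.
Qed.

(** Together with [w1 + w2 = 1] this is a linear system of two equations in [w1] and [w2], with
    determinant [b - a]. *)
Lemma convex_comb_eq0 (F : fieldType) (a b w1 w2 : F) :
    b - a != 0 -> w1 + w2 = 1 ->
  w1 * a + w2 * b = 0 <-> w1 = b / (b - a) /\ w2 = - (a / (b - a)).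
Proof.
move=> ba_neq0 /(canRL (addKr _)) ->; split=> [w_eq0|[-> _]]; last by field.
suff -> : w1 = b / (b - a) by split=> //; field.
apply: (canRL (mulfK ba_neq0)); apply/eqP; rewrite -subr_eq0; apply/eqP.
by rewrite -[RHS]oppr0 -w_eq0; ring.
Qed.

Lemma hyperplane_simplex2 (R : realType) (a b : R) : a * b < 0 ->
  exists p : simplex2 R,
    [/\ weight1 p = b / (b - a), weight2 p = - (a / (b - a)) &
        [set p | weight1 p * a + weight2 p * b = 0] = [set p]].
Proof.
move=> ab_lt0; have ba_neq0 := mulr_lt0_sub_neq0 ab_lt0.
have p_simplex : simplex2 R (b / (b - a), - (a / (b - a))).
  split=> /=; last by field.
  (* Expanding the fraction by [b - a] makes the denominator a square and lets [a * b < 0] give the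
     sign of the numerator, without deciding which of [a] and [b] is the positive one. *)
  - have -> : b / (b - a) = (b ^+ 2 - a * b) / (b - a) ^+ 2 by field.
    by rewrite divr_ge0 ?sqr_ge0// subr_ge0 (le_trans (ltW ab_lt0)) ?sqr_ge0.
  - have -> : - (a / (b - a)) = (a ^+ 2 - a * b) / (b - a) ^+ 2 by field.
    by rewrite divr_ge0 ?sqr_ge0// subr_ge0 (le_trans (ltW ab_lt0)) ?sqr_ge0.
exists (SigSub (mem_set p_simplex)); split=> //.
apply/seteqP; split=> [p /= /(convex_comb_eq0 ba_neq0 (weightD p))[w1E w2E]|].
- apply/val_inj; case: p w1E w2E => [[x y] xy].
  by rewrite /weight1 /weight2 /= => -> ->.
- by move=> _ -> /=; apply/(convex_comb_eq0 ba_neq0 (weightD _)).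
Qed.

Lemma min_entropy_set1 (R : realType) (pi p : simplex2 R) :
  min_entropy pi [set p] = (relative_entropy p pi)%:E.
Proof. by rewrite /min_entropy image_set1 ereal_inf1. Qed.

Lemma relative_entropy_hyperplane (R : realType) (p pi : simplex2 R) (a b : R) :
    0 < weight1 pi -> 0 < weight2 pi -> a * b < 0 ->
    weight1 p = b / (b - a) -> weight2 p = - (a / (b - a)) ->
  let q := - (weight1 pi * a / (weight2 pi * b)) in
  relative_entropy p pi =
    - ln (weight1 pi * q `^ (a / (b - a)) + weight2 pi * q `^ (b / (b - a))).
Proof.
move=> pi1_gt0 pi2_gt0 ab_lt0 p1E p2E q.
have ba_neq0 := mulr_lt0_sub_neq0 ab_lt0.
have b_neq0 : b != 0 by apply: contraTneq ab_lt0 => ->; rewrite mulr0 ltxx.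
have a_neq0 : a != 0 by apply: contraTneq ab_lt0 => ->; rewrite mul0r ltxx.
have pi1_neq0 : weight1 pi != 0 by rewrite gt_eqF.
have pi2_neq0 : weight2 pi != 0 by rewrite gt_eqF.
have p1_gt0 : 0 < weight1 p.
  rewrite lt_neqAle weight1_ge0 eq_sym p1E.
  by rewrite mulf_neq0 ?invr_eq0.
have p2_gt0 : 0 < weight2 p.
  rewrite lt_neqAle weight2_ge0 eq_sym p2E.
  by rewrite oppr_eq0 mulf_neq0 ?invr_eq0.
have u_gt0 : 0 < weight1 p / weight1 pi by rewrite divr_gt0.
have v_gt0 : 0 < weight2 p / weight2 pi by rewrite divr_gt0.
have qE : q = weight2 p / weight2 pi / (weight1 p / weight1 pi).
  rewrite /q p1E p2E; field.
  by rewrite ?ba_neq0 ?b_neq0 ?pi1_neq0 ?pi2_neq0.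
have q_gt0 : 0 < q by rewrite qE divr_gt0.
(* The two exponents differ by 1, so a common power of [q] factors out and the cofactor
   [weight1 pi + weight2 pi * q] is rational in [a] and [b]. *)
have -> : b / (b - a) = a / (b - a) + 1 by field.
rewrite powRD; last by rewrite (gt_eqF q_gt0) implybT.
rewrite powRr1 ?ltW//.
have -> : weight1 pi * q `^ (a / (b - a)) +
    weight2 pi * (q `^ (a / (b - a)) * q) =
    q `^ (a / (b - a)) * (weight1 p / weight1 pi)^-1.
  rewrite p1E /q; field.
  by rewrite ?ba_neq0 ?b_neq0 ?pi1_neq0 ?pi2_neq0.
rewrite lnM ?posrE ?powR_gt0 ?invr_gt0// ln_powR lnV ?posrE//.
rewrite qE ln_div ?posrE// /relative_entropy.
have -> : a / (b - a) = - weight2 p by rewrite p2E opprK.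
(* Generalizing the logarithms protects their arguments from the substitution of [1 - weight2 p] for
   [weight1 p]; a polynomial identity remains. *)
move: (ln _) (ln _) => lnu lnv.
by rewrite -[weight1 p](addrK (weight2 p)) weightD; ring.
Qed.

Theorem mainTheorem3 (R : realType) (mu1 mu2 : law R) (rho : law R -> R)
    (pi : simplex2 R) (Psi1 Psi2 : R -> R) (r1 r2 : R)
    (rho_law : law_invariant rho)
    (pi1_gt0 : 0 < weight1 pi) (pi2_gt0 : 0 < weight2 pi)
    (rho_cont : continuous (fun p : simplex2 R => rho (mixture p mu1 mu2)))
    (Psi1_decr : {homo Psi1 : x y / x < y >-> y < x})
    (Psi2_decr : {homo Psi2 : x y / x < y >-> y < x})
    (H_Psi : forall r : R,
      rateH rho pi mu1 mu2 r =
      min_entropy pi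
        [set p | weight1 p * Psi1 r + weight2 p * Psi2 r = 0])
    (r1_zero : unique (fun r => Psi1 r = 0) r1)
    (r2_zero : unique (fun r => Psi2 r = 0) r2)
    (r12 : r1 <> r2) :
  forall r : R, Num.min r1 r2 < r < Num.max r1 r2 ->
    let q := - (weight1 pi * Psi1 r / (weight2 pi * Psi2 r)) in
    [/\ Psi1 r * Psi2 r < 0,
        forall lambda : R,
          (weight1 pi * Psi1 r * expR (- lambda * Psi1 r)
             + weight2 pi * Psi2 r * expR (- lambda * Psi2 r))
            / (weight1 pi * expR (- lambda * Psi1 r)
                 + weight2 pi * expR (- lambda * Psi2 r)) = 0
          <-> lambda = - (1 / (Psi2 r - Psi1 r)) * ln q &
        rateH rho pi mu1 mu2 r =
          (- ln (weight1 pi * q `^ (Psi1 r / (Psi2 r - Psi1 r))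
                 + weight2 pi * q `^ (Psi2 r / (Psi2 r - Psi1 r))))%:E].
Proof.
move=> r r_between q.
have Psi_lt0 : Psi1 r * Psi2 r < 0.
  exact: mulr_lt0_between_zeros r1_zero.1 r2_zero.1 r_between.
split=> // [lambda|]; first exact: tilted_mean_eq0.
have [p [p1E p2E pE]] := hyperplane_simplex2 Psi_lt0.
by rewrite H_Psi pE min_entropy_set1 (relative_entropy_hyperplane _ _ Psi_lt0).
Qed.
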